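(* There exist positive absolute constants $C_1,C_2$ such that the following holds. Let $2\le k\le n$ be integers and $r\in(0,1]$. In the network sequence model with probability matrix $\boldsymbol\Theta_0$, if $\|\boldsymbol\Theta_0\|_\infty\le r$, then the restricted least squares estimator $\widehat{\boldsymbol\Theta}^r$ satisfies $$\mathbb E\left[\frac{1}{n^{2}}\|\widehat{\boldsymbol\Theta}^r-\boldsymbol\Theta_0\|_F^2\right]\le \frac{C_1}{n^{2}}\|\boldsymbol\Theta_0-\boldsymbol\Theta_{*}\|_F^2+C_2\,r\left(\frac{\log k}{n}+\frac{k^2}{n^2}\right).$$
   Context: Network sequence model: $\boldsymbol\Theta_0$ is a fixed symmetric $n\times n$ matrix with entries in $[0,1]$ and zero diagonal. One observes $\boldsymbol A'=(\boldsymbol A_{ij},\,1\le j<i\le n)$, independent Bernoulli variables with $\mathbb P(\boldsymbol A_{ij}=1)=(\boldsymbol\Theta_0)_{ij}$; $\mathbb E$ is expectation with respect to their distribution. $[m]=\{1,\dots,m\}$. $\mathcal Z_{n,k}$ is the set of maps $z:[n]\to[k]$ with $|z^{-1}(a)|\ge 1$ for all $a\in[k]$. $\mathbb R^{k\times k}_{\rm sym}$ is the set of real symmetric $k\times k$ matrices. $\|\cdot\|_F$ is the Frobenius norm and $\|\cdot\|_\infty$ the entrywise supremum norm. Restricted least squares estimator: let $L(\boldsymbol Q,z)=\sum_{1\le j<i\le n}(\boldsymbol A_{ij}-\boldsymbol Q_{z(i)z(j)})^2$ and let $(\widehat{\boldsymbol Q}_r,\hat z_r)$ be a minimizer of $L(\boldsymbol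 Q,z)$ over $\boldsymbol Q\in\mathbb R^{k\times k}_{\rm sym}$ with $\|\boldsymbol Q\|_\infty\le r$ and $z\in\mathcal Z_{n,k}$. Then $\widehat{\boldsymbol\Theta}^r$ is the symmetric $n\times n$ matrix with zero diagonal and $\widehat{\boldsymbol\Theta}^r_{ij}=(\widehat{\boldsymbol Q}_r)_{\hat z_r(i)\hat z_r(j)}$ for $i>j$. $\boldsymbol\Theta_{*}$ is a best Frobenius-norm approximation of $\boldsymbol\Theta_0$ in $\mathcal T[k]=\{\boldsymbol\Theta:\ \exists z\in\mathcal Z_{n,k},\ \boldsymbol Q\in\mathbb R^{k\times k}_{\rm sym}$ with $\boldsymbol\Theta_{ij}=\boldsymbol Q_{z(i)z(j)}$ for $i\ne j$ and $\boldsymbol\Theta_{ii}=0$ for all $i\}$. *)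

(* Defs.v *)
From HB Require Import structures.
From mathcomp Require Export all_boot all_order all_algebra.
From mathcomp Require Export all_classical all_reals all_analysis.

Set Implicit Arguments.
Unset Strict Implicit.
Unset Printing Implicit Defensive.

Import Order.TTheory GRing.Theory Num.Theory.

Local Open Scope ring_scope.

(* Unordered vertex pairs, encoded as the pairs (i, j) with j < i. *)
Definition edge (n : nat) : finType :=
  {e : 'I_n * 'I_n | (e.2 < e.1)%N}.

(* A realization of A' = (A_ij, j < i). *)
Definition observation (n : nat) : finType := {ffun edge n -> bool}.

Definition frobenius (R : realType) (m n : nat) (M : 'M[R]_(m, n)) : R :=
  Num.sqrt (\sum_(i < m) \sum_(j < n) M i j ^+ 2).

Definition prob_matrix (R : realType) (n : nat) (Theta : 'M[R]_n) : Prop :=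
  [/\ Theta^T = Theta,
      forall i j, 0 <= Theta i j <= 1 &
      forall i, Theta i i = 0].

(* The joint law of A' is the product of Bernoulli laws; see
   [network_prob_cylinder] for the marginals and independence. *)
Definition network_pmf (R : realType) (n : nat) (Theta : 'M[R]_n)
    (a : observation n) : R :=
  \prod_(e : edge n) bernoulli_pmf (Theta (val e).1 (val e).2) (a e).

Definition network_expectation (R : realType) (n : nat) (Theta : 'M[R]_n)
    (f : observation n -> R) : R :=
  \sum_(a : observation n) network_pmf Theta a * f a.

(* The set Z_{n,k}. *)
Definition labelling (n k : nat) (z : 'I_n -> 'I_k) : Prop :=
  forall a : 'I_k, (1 <= #|[pred i : 'I_n | z i == a]|)%N.

(* The set T[k]. *)
Definition block_class (R : realType) (n k : nat) (Theta : 'M[R]_n) : Prop :=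
  exists (z : 'I_n -> 'I_k) (Q : 'M[R]_k),
    [/\ labelling z,
        Q^T = Q,
        forall i j, i != j -> Theta i j = Q (z i) (z j) &
        forall i, Theta i i = 0].

Definition best_approx (R : realType) (n k : nat)
    (Theta0 Theta : 'M[R]_n) : Prop :=
  block_class k Theta /\
  forall Theta' : 'M[R]_n, block_class k Theta' ->
    frobenius (Theta0 - Theta) <= frobenius (Theta0 - Theta').

Definition ls_loss (R : realType) (n k : nat) (a : observation n)
    (Q : 'M[R]_k) (z : 'I_n -> 'I_k) : R :=
  \sum_(e : edge n) ((a e)%:R - Q (z (val e).1) (z (val e).2)) ^+ 2.

(* [mx_norm] is the entrywise supremum norm. *)
Definition ls_feasible (R : realType) (n k : nat) (r : R)
    (Q : 'M[R]_k) (z : 'I_n -> 'I_k) : Prop :=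
  [/\ Q^T = Q, mx_norm Q <= r & labelling z].

Definition ls_minimizer (R : realType) (n k : nat) (r : R) (a : observation n)
    (Q : 'M[R]_k) (z : 'I_n -> 'I_k) : Prop :=
  ls_feasible r Q z /\
  forall (Q' : 'M[R]_k) (z' : 'I_n -> 'I_k), ls_feasible r Q' z' ->
    ls_loss a Q z <= ls_loss a Q' z'.

(* Minimizers are not unique: this says that Theta is induced by one of them,
   i.e. that Theta is a possible value of the estimator at the data a. *)
Definition restricted_lse (R : realType) (n k : nat) (r : R)
    (a : observation n) (Theta : 'M[R]_n) : Prop :=
  exists (Q : 'M[R]_k) (z : 'I_n -> 'I_k),
    [/\ ls_minimizer r a Q z,
        Theta^T = Theta,
        forall i, Theta i i = 0 &
        forall i j : 'I_n, (j < i)%N -> Theta i j = Q (z i) (z j)].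

Lemma network_prob_cylinder (R : realType) (n : nat) (Theta : 'M[R]_n)
    (S : edge n -> pred bool) :
  network_expectation Theta (fun a => [forall e, S e (a e)]%:R) =
  \prod_(e : edge n)
    \sum_(b | S e b) bernoulli_pmf (Theta (val e).1 (val e).2) b.
Proof.
rewrite /network_expectation /=.
under eq_bigr do rewrite mulr_natr mulrb.
rewrite -big_mkcond /= bigA_distr_big_dep /=; apply: eq_bigl => a.
by apply/forallP/familyP.
Qed.

(* Main.v *)
Require Import Defs.
From mathcomp Require Import ring lra zify.
Import Order.TTheory GRing.Theory Num.Theory.
Local Open Scope ring_scope.

(** Write [p e] for the edge probabilities, all in [0, r], and [w = A - p] for
    the noise.  Truncating the matrix of any block approximation of [Theta0] to
    the range [-r, r] moves its entries closer to those of [Theta0] and gives a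
    competitor [theta'] of the estimator [theta].  Comparing the two losses and
    expanding the squares ([basic_inequality]) gives
      |theta - p|^2 / 2 <= |theta' - p|^2 - 2 <w, theta' - p>
                           + (2 <w, theta - p> - |theta - p|^2 / 2).
    The middle term is centred because [theta'] is deterministic, so all rests
    on bounding the expectation of the last bracket by [r (n log k + k^2)] up
    to a constant, uniformly over block vectors [theta] with entries in
    [-r, r] ([labelled_supremum]).

    The factor [r] comes from a Bernstein-type estimate.  A Bernoulli variable
    of mean at most [r] has variance at most [r], and [|v e| <= 2 r] for
    [v = theta - p]; at the scale [lam = 1 / (64 r)] the quantities
    [lam * w e * v e] are therefore bounded, and the quadratic penalty
    dominates the fluctuations ([penalized_mgf]):
      E exp (lam * (2 <w, v> - |v|^2 / 4)) <= exp (- lam * |v|^2 / 8).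

    Exponential moments turn a supremum into a sum.  There are at most [k ^ n]
    labellings, which accounts for [n log k].  For a fixed labelling the values
    on the [k^2] blocks have to be discretized, and a net of uniform mesh would
    cost a logarithmic factor.  The mesh is instead adapted to the block: on a
    block of [N] edges the grid has step [d] with [N d^2] of order [r].
    Replacing a value by one of the two neighbouring grid points then costs
    only [r / 2] ([gain_rounding]), while the squared distances from [p] to the
    grid points grow so fast that the bounds [exp (- lam * |v|^2 / 8)], summed
    over the grid, stay below an absolute constant ([exists_block_grid]).
    Since the exponential of a sum over blocks is a product over blocks, the
    sum over all grid choices factorizes, and each labelling contributes a
    constant to the power [k^2] ([block_supremum]). *)

Set Implicit Arguments.
Unset Strict Implicit.
Unset Printing Implicit Defensive.

(** * Exponential moments of Bernoulli variables *)

(** This is [exp t <= 1 / (1 - t)], the inverse of the tangent bound at [- t];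
    the range [t <= 1/2] keeps [1 / (1 - t)] below the quadratic. *)
Lemma expR_le_quadratic (R : realType) (t : R) :
  t <= 2^-1 -> expR t <= 1 + t + 2 * t ^+ 2.
Proof.
move=> t_le.
have e_ge : 1 - t <= (expR t)^-1 by rewrite -expRN; exact: expR_ge1Dx.
have t_pos : 0 < 1 - t by lra.
have -> : expR t = (expR t)^-1^-1 by rewrite invrK.
apply: (@le_trans _ _ (1 - t)^-1).
  by rewrite lef_pV2 // posrE ?invr_gt0 ?expR_gt0.
rewrite -[X in X <= _]mul1r ler_pdivrMr //.
have : 0 <= t ^+ 2 * (1 - 2 * t) by apply: mulr_ge0; [exact: sqr_ge0 | lra].
nra.
Qed.

(** The exponent is proportional to the mean [p], hence to the variance up to a
    constant, and not only to the range: the factor [r] of the final bound is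
    gained here.  The moment equals [exp (- t p) * (1 + p (exp t - 1))], which
    is at most [exp (p (exp t - 1 - t))]. *)
Lemma bernoulli_mgf (R : realType) (p t : R) : 0 <= p -> t <= 2^-1 ->
  \sum_(b : bool) bernoulli_pmf p b * expR (t * (b%:R - p))
    <= expR (2 * p * t ^+ 2).
Proof.
move=> p_ge0 t_le.
rewrite big_bool /= /bernoulli_pmf.
have -> : p * expR (t * (1 - p)) + (1 - p) * expR (t * (0 - p)) =
    expR (- (t * p)) * (1 + p * (expR t - 1)).
  have -> : t * (1 - p) = - (t * p) + t by ring.
  by rewrite expRD sub0r mulrN; ring.
apply: (@le_trans _ _ (expR (- (t * p)) * expR (p * (expR t - 1)))).
  by rewrite ler_wpM2l ?expR_ge0 ?expR_ge1Dx.
rewrite -expRD ler_expR.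
have := ler_wpM2l p_ge0 (expR_le_quadratic t_le).
nra.
Qed.

(** * Expectation under the network law *)

Section Expectation.
Variables (R : realType) (n : nat) (Theta : 'M[R]_n).
Hypothesis Theta_prob : prob_matrix Theta.

Definition edge_entry (M : 'M[R]_n) (e : edge n) : R :=
  M (val e).1 (val e).2.

Definition noise (a : observation n) (e : edge n) : R :=
  (a e)%:R - edge_entry Theta e.

Local Notation Ex := (network_expectation Theta).

Lemma edge_entry_ge0 e : 0 <= edge_entry Theta e.
Proof. by have [_ /(_ (val e).1 (val e).2)/andP[]] := Theta_prob. Qed.

Lemma network_pmf_ge0 a : 0 <= network_pmf Theta a.
Proof.
apply: prodr_ge0 => e _; rewrite /bernoulli_pmf.
have [_ /(_ (val e).1 (val e).2)/andP[? ?] _] := Theta_prob.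
by case: ifP => _ //; rewrite subr_ge0.
Qed.

(** Independence of the edges. *)
Lemma expectation_prod (f : edge n -> bool -> R) :
  Ex (fun a => \prod_e f e (a e)) =
  \prod_e \sum_(b : bool) bernoulli_pmf (edge_entry Theta e) b * f e b.
Proof.
rewrite bigA_distr_bigA; apply: eq_bigr => a _.
by rewrite /network_pmf -big_split.
Qed.

Lemma sum_bernoulli_pmf (p : R) : \sum_(b : bool) bernoulli_pmf p b = 1.
Proof. by rewrite big_bool /bernoulli_pmf /=; ring. Qed.

Lemma expectation_cst c : Ex (fun=> c) = c.
Proof.
rewrite /network_expectation -mulr_suml.
have -> : \sum_a network_pmf Theta a = Ex (fun a => \prod_(e : edge n) 1).
  by apply: eq_bigr => a _; rewrite big1_eq mulr1.
rewrite (expectation_prod (fun _ _ => 1)) big1 ?mul1r // => e _.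
under eq_bigr do rewrite mulr1.
exact: sum_bernoulli_pmf.
Qed.

Lemma expectationD f g : Ex (fun a => f a + g a) = Ex f + Ex g.
Proof.
by rewrite -big_split; apply: eq_bigr => a _; rewrite mulrDr.
Qed.

Lemma expectationZ c f : Ex (fun a => c * f a) = c * Ex f.
Proof.
by rewrite mulr_sumr; apply: eq_bigr => a _; rewrite mulrCA.
Qed.

Lemma expectation_sum (I : finType) (P : pred I) (f : I -> observation n -> R) :
  Ex (fun a => \sum_(i | P i) f i a) = \sum_(i | P i) Ex (f i).
Proof.
by rewrite exchange_big; apply: eq_bigr => a _; rewrite mulr_sumr.
Qed.

Lemma le_expectation f g : (forall a, f a <= g a) -> Ex f <= Ex g.
Proof.
by move=> le_fg; apply: ler_sum => a _; rewrite ler_wpM2l ?network_pmf_ge0.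
Qed.

Lemma expectation_noise e : Ex (noise^~ e) = 0.
Proof.
rewrite /noise expectationD expectation_cst.
have -> : Ex (fun a => (a e)%:R) =
    Ex (fun a => \prod_e' (if e' == e then (a e')%:R else 1)).
  apply: eq_bigr => a _; congr (_ * _).
  by rewrite -big_mkcond big_pred1_eq.
rewrite (expectation_prod (fun e' b => if e' == e then b%:R else 1)).
rewrite (bigD1 e) //= eqxx [X in _ * X]big1 ?mulr1 => [|e' /negPf ->].
  by rewrite big_bool /bernoulli_pmf /= mulr1 mulr0 addr0 subrr.
under eq_bigr do rewrite mulr1.
exact: sum_bernoulli_pmf.
Qed.

(** Jensen's inequality for the logarithm, in the form [1 + y <= exp y] at
    [y = X - ln T]. *)
Lemma expectation_le_ln (X : observation n -> R) (T : R) : 0 < T ->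
  Ex (fun a => expR (X a)) <= T -> Ex X <= ln T.
Proof.
move=> T_gt0 le_T.
have : Ex X <= Ex (fun a => (ln T - 1) + T^-1 * expR (X a)).
  apply: le_expectation => a.
  have := expR_ge1Dx (X a - ln T).
  rewrite expRB lnK ?posrE // [_ / T]mulrC => le_X; lra.
rewrite expectationD expectation_cst expectationZ => /le_trans; apply.
rewrite -lerBrDl opprB addrC subrK.
by rewrite ler_pdivrMl // mulr1.
Qed.

Lemma noise_mgf (v : edge n -> R) : (forall e, v e <= 2^-1) ->
  Ex (fun a => expR (\sum_e v e * noise a e))
    <= expR (\sum_e 2 * edge_entry Theta e * v e ^+ 2).
Proof.
move=> v_le; rewrite expR_sum.
have -> : Ex (fun a => expR (\sum_e v e * noise a e)) =
    Ex (fun a => \prod_e expR (v e * ((a e)%:R - edge_entry Theta e))).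
  by apply: eq_bigr => a _; rewrite expR_sum.
rewrite (expectation_prod
  (fun e b => expR (v e * (b%:R - edge_entry Theta e)))).
apply: ler_prod => e _; rewrite bernoulli_mgf ?edge_entry_ge0 ?v_le // andbT.
apply: sumr_ge0 => b _; rewrite mulr_ge0 ?expR_ge0 // /bernoulli_pmf.
have [_ /(_ (val e).1 (val e).2)/andP[? ?] _] := Theta_prob.
by case: ifP => _ //; rewrite subr_ge0.
Qed.

End Expectation.

(** * Sums and grids on the line *)

Lemma geometric_sum_le (R : realType) (q : R) (n : nat) : 0 <= q < 1 ->
  \sum_(0 <= i < n) q ^+ i <= (1 - q)^-1.
Proof.
case/andP=> q_ge0 q_lt1; have q1_gt0 : 0 < 1 - q by rewrite subr_gt0.
rewrite big_mkord -[X in _ <= X]mul1r ler_pdivlMr // mulrC.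
by rewrite -opprB mulNr -subrX1 opprB gerBl exprn_ge0.
Qed.

(** With truncated subtraction, [j - j0 + (j0 - j)] is the distance between the
    two naturals. *)
Lemma two_sided_geometric_sum_le (R : realType) (q : R) (j0 m : nat) :
  0 <= q < 1 -> (j0 <= m)%N ->
  \sum_(0 <= j < m) q ^+ (j - j0 + (j0 - j)) <= 2 / (1 - q).
Proof.
move=> q01 le_j0m; have /andP[q_ge0 q_lt1] := q01.
rewrite (big_cat_nat _ le_j0m) //=.
rewrite [2 / _]mulrDl mul1r; apply: lerD; last first.
  rewrite -{1}[j0]add0n big_addn.
  under eq_bigr do rewrite addnK (eqP (leq_addl _ _)) addn0.
  exact: geometric_sum_le.
rewrite big_nat_rev /= add0n.
apply: le_trans (geometric_sum_le j0 q01).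
rewrite !big_nat; apply: ler_sum => j /andP[_ lt_j].
by rewrite ler_wiXn2l //; [exact: ltW | lia].
Qed.

Lemma monotone_bracket (R : realType) (g : nat -> R) (q : R) (m : nat) :
  (0 < m)%N -> g 0%N <= q <= g m ->
  exists2 j, (j < m)%N & g j <= q <= g j.+1.
Proof.
case: m => // m _; elim: m => [|m IHm] /andP[q_ge q_le].
  by exists 0%N; rewrite ?q_ge.
case: (lerP q (g m.+1)) => q_m; last by exists m.+1; rewrite // q_le ltW.
by have [|j lt_j q_j] := IHm; [rewrite q_ge | exists j; rewrite // ltnW].
Qed.

(** Used to choose the number of cells of a grid: [m] is of order [sqrt x],
    except that one cell is kept when [x] is small. *)
Lemma square_between (R : realType) (x : R) : 0 <= x ->
  exists m : nat, [/\ (0 < m)%N, x <= m%:R ^+ 2 &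
    m = 1%N \/ m%:R ^+ 2 <= 4 * x].
Proof.
move=> x_ge0.
pose P m := (0 < m)%N && (x <= m%:R ^+ 2).
have exP : exists m, P m.
  exists (Num.Def.archi_bound x).+1; rewrite /P /=.
  have := archi_boundP x_ge0; rewrite -natr1.
  have : 0 <= (Num.Def.archi_bound x)%:R :> R by [].
  nra.
case: (ex_minnP exP) => m /andP[m_gt0 m_ge] m_min; exists m; split => //.
case: m m_gt0 {m_ge} m_min => [//|[|m]] _ m_min; first by left.
right; have : ~~ P m.+1 by apply/negP => /m_min; rewrite ltnn.
rewrite /P /= -ltNge -[m.+2%:R]natr1 -[m.+1%:R]natr1.
have : 0 <= m%:R :> R by [].
nra.
Qed.

(** * Discretization of one block *)

Section Block.
Variables (R : realType) (I : finType) (P : pred I) (p : I -> R).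

Definition sqdist (x : R) : R := \sum_(i | P i) (x - p i) ^+ 2.

(** The part of the penalized noise carried by one block, on which a candidate
    has the common value [x]; the penalty strength [c] is 1/2 before rounding
    [x] to a grid and 1/4 after. *)
Definition gain (c : R) (w : I -> R) (x : R) : R :=
  \sum_(i | P i) (2 * w i * (x - p i) - c * (x - p i) ^+ 2).

(** The correlation with the noise is affine in the common value, so moving to a
    suitable endpoint of the interval does not decrease it.  Rounding in the
    direction of the noise avoids any bound on the size of the noise; only the
    penalty is perturbed, and weakening it from 1/2 to 1/4 absorbs the change up
    to the square of the mesh. *)
Lemma gain_rounding (w : I -> R) (lo hi x : R) : lo <= x <= hi ->
  exists2 y, y = lo \/ y = hi &
    gain 2^-1 w x <= gain 4^-1 w y + #|P|%:R * (hi - lo) ^+ 2 / 2.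
Proof.
case/andP=> lo_x x_hi.
set W := \sum_(i | P i) w i.
pose y := if 0 <= W then hi else lo.
exists y; first by rewrite /y; case: ifP; [right | left].
have W_y : 0 <= W * (y - x).
  rewrite /y; case: (lerP 0 W) => [W_ge0|W_lt0].
    by rewrite mulr_ge0 // subr_ge0.
  by rewrite mulr_le0 ?subr_le0 // ltW.
have y_near : (y - x) ^+ 2 <= (hi - lo) ^+ 2.
  by rewrite /y; case: ifP => _; nra.
have -> : gain 2^-1 w x = \sum_(i | P i)
    (2 * w i * (y - p i) - 2^-1 * (x - p i) ^+ 2) - 2 * (W * (y - x)).
  rewrite mulrA mulr_sumr mulr_suml -sumrB; apply: eq_bigr => i _; ring.
have -> : #|P|%:R * (hi - lo) ^+ 2 / 2 =
    \sum_(i | P i) ((hi - lo) ^+ 2 / 2).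
  by rewrite sumr_const -mulrA mulr_natl.
rewrite -big_split /=; apply: (@le_trans _ _ (\sum_(i | P i)
    (2 * w i * (y - p i) - 2^-1 * (x - p i) ^+ 2))).
  by rewrite gerBl mulr_ge0.
apply: ler_sum => i _.
have := sqr_ge0 (y - x - (x - p i)); nra.
Qed.

(** The triangle inequality through [p].  Taking for [x] the best grid point
    shows that [sqdist] grows quadratically away from it, which serves the
    purpose of a bias-variance decomposition around the mean of [p]. *)
Lemma sqdist_separation (x y : R) : sqdist x <= sqdist y ->
  #|P|%:R * (y - x) ^+ 2 / 4 <= sqdist y.
Proof.
move=> le_xy.
have -> : #|P|%:R * (y - x) ^+ 2 / 4 = \sum_(i | P i) ((y - x) ^+ 2 / 4).
  by rewrite sumr_const -mulrA mulr_natl.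
apply: (@le_trans _ _ (2^-1 * sqdist x + 2^-1 * sqdist y)); last lra.
rewrite /sqdist !mulr_sumr -big_split /=; apply: ler_sum => i _.
have := sqr_ge0 (y - p i + (x - p i)); nra.
Qed.

Definition grid (r : R) (m j : nat) : R := - r + 2 * r * j%:R / m%:R.

Lemma grid_bounds (r : R) (m j : nat) : 0 <= r -> (j <= m)%N ->
  - r <= grid r m j <= r.
Proof.
move=> r_ge0 le_jm; rewrite /grid.
have : 0 <= (j%:R / m%:R : R) <= 1.
  case: m le_jm => [|m] le_jm; first by rewrite invr0 mulr0; apply/andP; split.
  by rewrite divr_ge0 //= ler_pdivrMr ?ltr0Sn // mul1r ler_nat.
rewrite -mulrA; move: (j%:R / m%:R) => t /andP[t_ge0 t_le1].
by apply/andP; split; nra.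
Qed.

(** The sum of the two-sided geometric series that dominates the sum over a grid
    in [exists_block_grid]. *)
Definition packing_const (c : R) : R := 2 / (1 - expR (- (c / 16))).

Lemma packing_rate (c : R) : 0 < c -> 0 <= (expR (- (c / 16)) : R) < 1.
Proof. by move=> c_gt0; rewrite expR_ge0 expR_lt1 oppr_lt0 divr_gt0. Qed.

Lemma packing_const_ge2 (c : R) : 0 < c -> 2 <= packing_const c.
Proof.
move=> /packing_rate/andP[q_ge0 q_lt1].
rewrite ler_peMr // invf_ge1 ?subr_gt0 //; lra.
Qed.

(** The number of cells [m] is the least one for which the step [d = 2 r / m]
    satisfies [#|P| d^2 <= r], so that rounding costs at most [r / 2].  By
    minimality either [m = 1], and the sum has two terms, or
    [#|P| d^2 >= r / 4]; then the squared distance at the [j]-th point is at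
    least [r (j - j0)^2 / 16], with [j0] the best point, and the sum is
    dominated by a two-sided geometric series. *)
Lemma exists_block_grid (r c : R) : 0 < r -> 0 < c ->
  exists m : nat,
    (forall w x, - r <= x <= r -> exists2 j, (j <= m)%N &
       gain 2^-1 w x <= gain 4^-1 w (grid r m j) + r / 2) /\
    \sum_(0 <= j < m.+1) expR (- (c / r * sqdist (grid r m j)))
      <= packing_const c.
Proof.
move=> r_gt0 c_gt0; have r_ge0 := ltW r_gt0.
set N : R := #|P|%:R; have N_ge0 : 0 <= N by rewrite /N.
have [|m [m_gt0 m_ge m_le]] := @square_between _ (4 * N * r).
  by rewrite !mulr_ge0.
have m0 : 0 < m%:R :> R by rewrite ltr0n.
have m2 : 0 < m%:R ^+ 2 :> R by rewrite exprn_gt0.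
exists m; split=> [w x x_r|].
  have [|j lt_j x_j] := @monotone_bracket _ (grid r m) x m m_gt0.
    rewrite /grid mulr0 mul0r addr0 mulfK ?gt_eqF //.
    by have -> : - r + 2 * r = r by ring.
  have [y y_j le_y] := gain_rounding w x_j.
  have step : N * (grid r m j.+1 - grid r m j) ^+ 2 / 2 <= r / 2.
    rewrite ler_wpM2r // /grid -[j.+1%:R]natr1.
    have -> : N * (- r + 2 * r * (j%:R + 1) / m%:R -
        (- r + 2 * r * j%:R / m%:R)) ^+ 2 = 4 * N * r * r / m%:R ^+ 2.
      by field; rewrite gt_eqF.
    by rewrite ler_pdivrMr // mulrC ler_wpM2l.
  case: y_j le_y => -> le_y; [exists j | exists j.+1] => //; try exact: ltnW;
    by apply: le_trans le_y _; rewrite lerD2l.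
case: m_le => [m1|m_le].
  apply: le_trans (packing_const_ge2 c_gt0); rewrite m1.
  have D_ge0 x : 0 <= sqdist x by apply: sumr_ge0 => i _; exact: sqr_ge0.
  have le1 x : expR (- (c / r * sqdist x)) <= 1.
    by rewrite expR_le1 oppr_le0 mulr_ge0 // divr_ge0 // ltW.
  by rewrite big_nat_recr //= big_nat1 lerD.
(* The best point replaces the block mean of p as centre of the sum. *)
pose j0 := [arg min_(j < ord0 : 'I_m.+1) sqdist (grid r m j)]%O.
have j0_min (j : 'I_m.+1) : sqdist (grid r m j0) <= sqdist (grid r m j).
  by rewrite /j0; case: arg_minP => // i _; apply.
apply: le_trans
  (two_sided_geometric_sum_le (packing_rate c_gt0) (ltnW (ltn_ord j0))).
rewrite !big_nat; apply: ler_sum => j /andP[_ lt_j].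
rewrite -expRM_natr ler_expR mulNr lerN2.
have := sqdist_separation (j0_min (Ordinal lt_j)) => /=; rewrite -/N.
set D := sqdist _; set d : R := (_ + _)%:R => D_ge.
have d2 : d <= (j%:R - j0%:R) ^+ 2.
  rewrite /d; case: (leqP j0 j) => le_j.
    rewrite (eqP le_j) addn0 -natrB // -natrX ler_nat; nia.
  have /eqP -> : (j - j0 == 0)%N by rewrite subn_eq0 ltnW.
  rewrite add0n -[(_ - _) ^+ 2]sqrrN opprB -natrB ?(ltnW le_j) //.
  by rewrite -natrX ler_nat; nia.
have step : r / 16 * (j%:R - j0%:R) ^+ 2 <= D.
  apply: le_trans D_ge; rewrite /grid.
  have -> : N * (- r + 2 * r * j%:R / m%:R - (- r + 2 * r * j0%:R / m%:R)) ^+ 2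
      / 4 = N * r ^+ 2 / m%:R ^+ 2 * (j%:R - j0%:R) ^+ 2.
    by field; rewrite gt_eqF.
  rewrite ler_wpM2r ?sqr_ge0 // ler_pdivlMr //.
  have := ler_wpM2l r_ge0 m_le; nra.
apply: (@le_trans _ _ (c / r * (r / 16 * (j%:R - j0%:R) ^+ 2))); last first.
  by rewrite ler_wpM2l // divr_ge0 // ltW.
have -> : c / r * (r / 16 * (j%:R - j0%:R) ^+ 2) =
    c / 16 * (j%:R - j0%:R) ^+ 2 by field; rewrite gt_eqF.
by rewrite ler_wpM2l // divr_ge0 // ltW.
Qed.

End Block.

(** * Uniform control of the penalized noise *)

Section Supremum.
Variables (R : realType) (n : nat) (Theta : 'M[R]_n) (r : R).
Hypothesis Theta_prob : prob_matrix Theta.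
Hypothesis r_gt0 : 0 < r.
Hypothesis Theta_le : forall e, edge_entry Theta e <= r.

Local Notation Ex := (network_expectation Theta).

(** The scale [1 / (64 r)] is small enough for half of the penalty to absorb the
    logarithm of the moment generating function, which leaves a summable
    weight [exp (- |v|^2 / (512 r))]. *)
Lemma penalized_mgf (v : edge n -> R) : (forall e, `|v e| <= 2 * r) ->
  Ex (fun a => expR ((64 * r)^-1 *
        \sum_e (2 * noise Theta a e * v e - 4^-1 * v e ^+ 2)))
    <= expR (- ((8 * 64)^-1 / r * \sum_e v e ^+ 2)).
Proof.
move=> v_le; have r0 : r != 0 by rewrite gt_eqF.
pose u e := (32 * r)^-1 * v e.
have -> : Ex (fun a => expR ((64 * r)^-1 *
      \sum_e (2 * noise Theta a e * v e - 4^-1 * v e ^+ 2))) =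
    expR (- ((4 * 64)^-1 / r * \sum_e v e ^+ 2)) *
    Ex (fun a => expR (\sum_e u e * noise Theta a e)).
  rewrite -expectationZ; apply: eq_bigr => a _; congr (_ * _).
  rewrite -expRD; congr expR; rewrite !mulr_sumr -sumrN -big_split /=.
  by apply: eq_bigr => e _; rewrite /u; field.
have u_le e : u e <= 2^-1.
  have := v_le e; rewrite ler_norml => /andP[_ ve].
  by rewrite /u ler_pdivrMl ?mulr_gt0 //; have := r_gt0; lra.
have := noise_mgf Theta_prob u_le => le_mgf.
apply: (@le_trans _ _ (expR (- ((4 * 64)^-1 / r * \sum_e v e ^+ 2)) *
    expR ((8 * 64)^-1 / r * \sum_e v e ^+ 2))); last first.
  rewrite -expRD ler_expR le_eqVlt; apply/orP; left; apply/eqP.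
  by move: (\sum_e _) => S; field.
rewrite ler_wpM2l ?expR_ge0 //; apply: le_trans le_mgf _.
rewrite ler_expR mulr_sumr; apply: ler_sum => e _.
have -> : (8 * 64)^-1 / r * v e ^+ 2 = 2 * r * u e ^+ 2 by rewrite /u; field.
by rewrite ler_wpM2r ?sqr_ge0 // ler_wpM2l.
Qed.

(** Cost of one block: the rounding error [r / 2] at the scale [1 / (64 r)],
    times the sum over the grid. *)
Definition block_const : R := expR (2 * 64)^-1 * packing_const (8 * 64)^-1.

Lemma block_const_gt1 : 1 < block_const.
Proof.
have rate : 0 < (8 * 64)^-1 :> R by rewrite invr_gt0 mulr_gt0.
have := packing_const_ge2 rate => K_ge2.
have e_ge1 : 1 <= expR (2 * 64)^-1 :> R.
  by rewrite ltW // expR_gt1 invr_gt0 mulr_gt0.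
rewrite /block_const; move: (expR _) (packing_const _) e_ge1 K_ge2 => x y.
nra.
Qed.

Definition penalized_gain (c : R) (a : observation n)
  (theta : edge n -> R) : R :=
  \sum_e (2 * noise Theta a e * (theta e - edge_entry Theta e)
          - c * (theta e - edge_entry Theta e) ^+ 2).

Lemma penalized_gain_blocks (B : finType) (beta : edge n -> B) c a
    (Q : B -> R) :
  penalized_gain c a (Q \o beta) =
  \sum_b gain (fun e => beta e == b) (edge_entry Theta) c (noise Theta a) (Q b).
Proof.
rewrite /penalized_gain (partition_big beta predT) //=.
by apply: eq_bigr => b _; apply: eq_bigr => e /eqP <-.
Qed.

(** [Phi] is a product over blocks of sums over the grids.  It dominates the
    exponential of the supremum over all block values, although it involves
    finitely many of them; its expectation is computed by expanding the
    product. *)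
Lemma block_supremum (B : finType) (beta : edge n -> B) :
  exists Phi : observation n -> R,
    (forall a (Q : B -> R), (forall b, - r <= Q b <= r) ->
       expR ((64 * r)^-1 * penalized_gain 2^-1 a (Q \o beta)) <= Phi a) /\
    Ex Phi <= block_const ^+ #|B|.
Proof.
have rate : 0 < (8 * 64)^-1 :> R by rewrite invr_gt0 mulr_gt0.
pose p := edge_entry Theta.
have /choice[m m_grid] b :=
  exists_block_grid (fun e => beta e == b) p r_gt0 rate.
pose lam := (64 * r)^-1.
have lam_ge0 : 0 <= lam by rewrite invr_ge0 mulr_ge0 // ltW.
pose cell a b x := gain (fun e => beta e == b) p 4^-1 (noise Theta a) x.
pose K0 : R := expR (2 * 64)^-1.
have K0_ge0 : 0 <= K0 := expR_ge0 _.
exists (fun a => \prod_b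
  (K0 * \sum_(0 <= j < (m b).+1) expR (lam * cell a b (grid r (m b) j)))).
split=> [a Q Q_le|].
  rewrite penalized_gain_blocks mulr_sumr expR_sum.
  apply: ler_prod => b _; rewrite expR_ge0 /=.
  have [/(_ (noise Theta a) (Q b) (Q_le b))[j le_j gain_le] _] := m_grid b.
  apply: (@le_trans _ _ (K0 * expR (lam * cell a b (grid r (m b) j)))).
    rewrite -expRD ler_expR.
    have -> : (2 * 64)^-1 + lam * cell a b (grid r (m b) j) =
        lam * (cell a b (grid r (m b) j) + r / 2).
      by rewrite /lam; field; rewrite gt_eqF.
    by rewrite ler_wpM2l.
  rewrite ler_wpM2l // big_mkord (bigD1 (Ordinal (n := (m b).+1) le_j)) //=.
  by rewrite lerDl sumr_ge0 // => i _; exact: expR_ge0.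
(* A common index type for the grids, whose sizes depend on the block, so
   that the product of sums can be expanded. *)
pose M := \max_b (m b).+1.
pose Qm b := [pred j : 'I_M | (j < (m b).+1)%N].
have widen b (F : nat -> R) :
    \sum_(0 <= j < (m b).+1) F j = \sum_(j : 'I_M | Qm b j) F j.
  by rewrite big_mkord (big_ord_widen M) // (leq_bigmax b).
have -> : Ex (fun a => \prod_b
    (K0 * \sum_(0 <= j < (m b).+1) expR (lam * cell a b (grid r (m b) j)))) =
  K0 ^+ #|B| * \sum_(J in family Qm)
    Ex (fun a => expR (lam *
      penalized_gain 4^-1 a ((fun b => grid r (m b) (J b)) \o beta))).
  rewrite -expectation_sum -expectationZ; apply: eq_bigr => a _.
  congr (_ * _); rewrite big_split prodr_const /=; congr (_ * _).
  under eq_bigr do rewrite widen.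
  rewrite bigA_distr_big_dep; apply: eq_bigr => J _.
  by rewrite penalized_gain_blocks mulr_sumr expR_sum.
rewrite exprMn ler_wpM2l ?exprn_ge0 //.
apply: (@le_trans _ _ (\sum_(J in family Qm) \prod_b
    expR (- ((8 * 64)^-1 / r *
      sqdist (fun e => beta e == b) p (grid r (m b) (J b)))))).
  apply: ler_sum => J /familyP J_le.
  pose v e := grid r (m (beta e)) (J (beta e)) - p e.
  have v_le e : `|v e| <= 2 * r.
    have /andP[] : - r <= grid r (m (beta e)) (J (beta e)) <= r.
      by apply: grid_bounds (ltW r_gt0) _; have := J_le (beta e); rewrite inE.
    have := Theta_le e; have := edge_entry_ge0 Theta_prob e.
    rewrite /v /p ler_norml; move: (edge_entry _ e) (grid _ _ _) => x y.
    by move=> x_ge0 x_le y_ge y_le; apply/andP; split; lra.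
  apply: le_trans (penalized_mgf v_le) _.
  rewrite -expR_sum ler_expR sumrN lerN2 -mulr_sumr ler_wpM2l //.
    by rewrite divr_ge0 // ltW.
  rewrite (partition_big beta predT) //=; apply: ler_sum => b _.
  by apply: ler_sum => e /eqP <-.
rewrite -(bigA_distr_big_dep _ (fun b (j : 'I_M) => expR (- ((8 * 64)^-1 / r *
  sqdist (fun e => beta e == b) p (grid r (m b) j))))) -prodr_const.
apply: ler_prod => b _; apply/andP; split.
  by apply: sumr_ge0 => j _; exact: expR_ge0.
rewrite -(widen b (fun j => expR (- ((8 * 64)^-1 / r *
  sqdist (fun e => beta e == b) p (grid r (m b) j))))).
by have [_] := m_grid b.
Qed.

(** The label pairs [(z i, z j)] serve as blocks, which ignores the symmetry of
    the block matrix and costs a factor of about two in the number of blocks.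
    The maximum over labellings is bounded by the sum, inside the
    exponential. *)
Lemma labelled_supremum (k : nat)
    (theta : observation n -> edge n -> R) : (0 < k)%N ->
  (forall a, exists (z : 'I_n -> 'I_k) (Q : 'I_k * 'I_k -> R),
     (forall b, - r <= Q b <= r) /\
     forall e, theta a e = Q (z (val e).1, z (val e).2)) ->
  Ex (fun a => penalized_gain 2^-1 a (theta a)) <=
  64 * r * (n%:R * ln k%:R + k%:R ^+ 2 * ln block_const).
Proof.
move=> k_gt0 theta_block.
have K_gt0 : 0 < block_const := lt_trans ltr01 block_const_gt1.
have k0 : 0 < k%:R :> R by rewrite ltr0n.
have /choice[Phi Phi_sup] (z : {ffun 'I_n -> 'I_k}) :=
  block_supremum (fun e : edge n => (z (val e).1, z (val e).2)).
pose T : R := k%:R ^+ n * block_const ^+ (k * k).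
have T_gt0 : 0 < T by rewrite mulr_gt0 ?exprn_gt0.
have -> : n%:R * ln k%:R + k%:R ^+ 2 * ln block_const = ln T.
  rewrite /T lnM ?posrE ?exprn_gt0 // lnXn // lnXn //.
  by rewrite -natrX !mulr_natl mulnn.
rewrite -ler_pdivrMl ?mulr_gt0 // -expectationZ.
apply: (expectation_le_ln Theta_prob T_gt0).
apply: (@le_trans _ _ (Ex (fun a => \sum_z Phi z a))).
  apply: (le_expectation Theta_prob) => a.
  have [z [Q [Q_le theta_Q]]] := theta_block a.
  pose z' := [ffun i => z i].
  have -> : theta a = Q \o (fun e : edge n => (z' (val e).1, z' (val e).2)).
    by apply/funext => e; rewrite theta_Q /= !ffunE.
  have [/(_ a Q Q_le) le_Phi _] := Phi_sup z'.
  apply: le_trans le_Phi _; rewrite (bigD1 z') //= lerDl sumr_ge0 // => z1 _.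
  have [/(_ a (fun=> 0)) le_Phi _] := Phi_sup z1.
  apply: le_trans (le_Phi _) => [|_]; first exact: expR_ge0.
  by rewrite oppr_le0 (ltW r_gt0).
rewrite expectation_sum.
apply: (@le_trans _ _ (\sum_(z : {ffun 'I_n -> 'I_k}) block_const ^+ (k * k))).
  apply: ler_sum => z _; have [_] := Phi_sup z.
  by rewrite card_prod card_ord.
by rewrite sumr_const card_ffun !card_ord /T -natrX mulr_natl.
Qed.

End Supremum.

(** * Comparison with the best approximation *)

Section Matrices.
Variables (R : realType).

Lemma entry_le_mx_norm (n : nat) (M : 'M[R]_n) (i j : 'I_n) :
  `|M i j| <= mx_norm M.
Proof.
rewrite mx_normrE.
exact: (le_bigmax _ (fun ij : 'I_n * 'I_n => `|M ij.1 ij.2|) (i, j)).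
Qed.

Lemma mx_norm_le (n : nat) (M : 'M[R]_n) (r : R) : 0 <= r ->
  (forall i j, `|M i j| <= r) -> mx_norm M <= r.
Proof. by move=> r_ge0 M_le; rewrite mx_normrE; apply: bigmax_le. Qed.

Lemma frobenius_edges (n : nat) (M : 'M[R]_n) : M^T = M ->
  (forall i, M i i = 0) ->
  frobenius M ^+ 2 = 2 * \sum_e edge_entry M e ^+ 2.
Proof.
move=> M_sym M_diag.
have sum_ge0 : 0 <= \sum_i \sum_j M i j ^+ 2.
  by apply: sumr_ge0 => i _; apply: sumr_ge0 => j _; exact: sqr_ge0.
rewrite /frobenius sqr_sqrtr // pair_bigA /=.
have -> : \sum_e edge_entry M e ^+ 2 =
    \sum_(ij : 'I_n * 'I_n | (ij.2 < ij.1)%N) M ij.1 ij.2 ^+ 2.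
  by rewrite (big_sub [pred ij : 'I_n * 'I_n | (ij.2 < ij.1)%N]
                      (fun ij => M ij.1 ij.2 ^+ 2)).
rewrite (bigID (fun ij : 'I_n * 'I_n => (ij.2 < ij.1)%N)) /=.
rewrite mulrDl mul1r; congr (_ + _).
rewrite (bigID (fun ij : 'I_n * 'I_n => (ij.1 < ij.2)%N)) /= addrC big1 ?add0r.
  have swapK : involutive (fun ij : 'I_n * 'I_n => (ij.2, ij.1)) by case.
  rewrite (reindex_inj (inv_inj swapK)) /=.
  apply: eq_big => [[i j]|[i j] _] /=; first by case: (ltngtP i j).
  by rewrite -{1}M_sym mxE.
move=> [i j] /=; rewrite -!leqNgt => /andP[le_ij le_ji].
have -> : i = j by apply/val_inj/eqP; rewrite eqn_leq le_ij.
by rewrite M_diag expr0n.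
Qed.

End Matrices.

Definition clip (R : realType) (r x : R) : R := Num.max (- r) (Num.min r x).

Lemma clip_bounds (R : realType) (r x : R) : 0 <= r -> - r <= clip r x <= r.
Proof.
move=> r_ge0; rewrite /clip /Num.max /Num.min.
by case: (ltP r x) => ?; case: ltP => ?; apply/andP; split; lra.
Qed.

Lemma clip_closer (R : realType) (r x p : R) : 0 <= p <= r ->
  (clip r x - p) ^+ 2 <= (p - x) ^+ 2.
Proof.
case/andP=> p_ge0 p_le; rewrite /clip /Num.max /Num.min.
by case: (ltP r x) => ?; case: ltP => ?; nra.
Qed.

Definition block_edge (R : realType) (n k : nat) (Q : 'M[R]_k)
  (z : 'I_n -> 'I_k) (e : edge n) : R := Q (z (val e).1) (z (val e).2).

(** The square of the noise is common to both losses and cancels.  Half of the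
    squared error is kept inside [penalized_gain], whence the factor two. *)
Lemma basic_inequality (R : realType) (n k : nat) (Theta0 : 'M[R]_n) (r : R)
    (a : observation n) (Q Q' : 'M[R]_k) (z z' : 'I_n -> 'I_k)
    (p := edge_entry Theta0) :
  ls_minimizer r a Q z -> ls_feasible r Q' z' ->
  \sum_e (block_edge Q z e - p e) ^+ 2 <=
  2 * (\sum_e (block_edge Q' z' e - p e) ^+ 2
       + penalized_gain Theta0 2^-1 a (block_edge Q z)
       - 2 * \sum_e (block_edge Q' z' e - p e) * noise Theta0 a e).
Proof.
move=> [_ /(_ Q' z') min_Q] /min_Q le_loss.
set theta := block_edge Q z; set theta' := block_edge Q' z'.
have : ls_loss a Q z = \sum_e (theta e - p e) ^+ 2 / 2
    - penalized_gain Theta0 2^-1 a theta + \sum_e noise Theta0 a e ^+ 2.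
  rewrite /ls_loss /penalized_gain -sumrB -big_split /=.
  apply: eq_bigr => e _; rewrite /noise /p /theta /block_edge.
  by move: (edge_entry _ _) (Q _ _) => x y; field.
have : ls_loss a Q' z' = \sum_e (theta' e - p e) ^+ 2
    - 2 * (\sum_e (theta' e - p e) * noise Theta0 a e)
    + \sum_e noise Theta0 a e ^+ 2.
  rewrite /ls_loss mulr_sumr -sumrB -big_split /=.
  apply: eq_bigr => e _; rewrite /noise /p /theta' /block_edge.
  by move: (edge_entry _ _) (Q' _ _) => x y; ring.
rewrite -mulr_suml; lra.
Qed.

Theorem proposition2p3 (R : realType) :
  exists C1 C2 : R, 0 < C1 /\ 0 < C2 /\
  forall (n k : nat) (r : R) (Theta0 Thetastar : 'M[R]_n)
         (Thetahat : observation n -> 'M[R]_n),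
    (2 <= k)%N -> (k <= n)%N ->
    0 < r -> r <= 1 ->
    prob_matrix Theta0 ->
    mx_norm Theta0 <= r ->
    best_approx k Theta0 Thetastar ->
    (forall a : observation n, restricted_lse k r a (Thetahat a)) ->
    network_expectation Theta0
      (fun a => (n%:R ^+ 2)^-1 * frobenius (Thetahat a - Theta0) ^+ 2)
    <= C1 / n%:R ^+ 2 * frobenius (Theta0 - Thetastar) ^+ 2
       + C2 * r * (ln k%:R / n%:R + k%:R ^+ 2 / n%:R ^+ 2).
Proof.
have lnK_gt0 : 0 < ln (block_const R) := ln_gt0 (block_const_gt1 R).
exists 2, (256 * (1 + ln (block_const R))); split; first by [].
split; first by rewrite mulr_gt0 // addr_gt0.
move=> n k r Theta0 Thetastar Thetahat k_ge2 k_le_n r_gt0 _ prob0 norm0.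
move=> [[zs [Qs [lab_zs Qs_sym Qs_off Qs_diag]]] _] hat.
have r_ge0 := ltW r_gt0.
have k_gt0 : (0 < k)%N by rewrite (leq_trans _ k_ge2).
have n_gt0 : 0 < n%:R :> R by rewrite ltr0n (leq_trans _ k_le_n).
have [sym0 _ diag0] := prob0.
pose p := edge_entry Theta0.
have p_le e : p e <= r.
  apply: le_trans norm0; apply: le_trans (entry_le_mx_norm _ _ _).
  exact: ler_norm.
(* The block matrix of the approximation may have entries outside [-r, r],
   for instance on the diagonal block of a singleton class. *)
pose Qc := map_mx (clip r) Qs.
have Qc_feasible : ls_feasible r Qc zs.
  split=> //; first by rewrite /Qc map_trmx Qs_sym.
  by apply: mx_norm_le => // i j; rewrite mxE ler_norml clip_bounds.
pose bias := \sum_e (block_edge Qc zs e - p e) ^+ 2.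
have bias_le : 2 * bias <= frobenius (Theta0 - Thetastar) ^+ 2.
  rewrite frobenius_edges; last 2 first.
  - rewrite linearB /= sym0; congr (_ - _); apply/matrixP => i j; rewrite mxE.
    have [->//|neq_ij] := eqVneq i j.
    rewrite (Qs_off i j) // (Qs_off j i) 1?eq_sym //.
    by rewrite -[in LHS]Qs_sym mxE.
  - by move=> i; rewrite !mxE diag0 Qs_diag subrr.
  rewrite ler_wpM2l //; apply: ler_sum => e _.
  rewrite /block_edge /edge_entry !mxE Qs_off; last first.
    by rewrite -val_eqE neq_ltn (valP e) orbT.
  by apply: clip_closer; rewrite (edge_entry_ge0 prob0 e); exact: (p_le e).
pose hatQ a e := edge_entry (Thetahat a) e.
have hat_norm a : frobenius (Thetahat a - Theta0) ^+ 2 =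
    2 * \sum_e (hatQ a e - p e) ^+ 2.
  have [Q [z [_ sym diag _]]] := hat a.
  rewrite frobenius_edges.
  - by congr (_ * _); apply: eq_bigr => e _; rewrite /edge_entry !mxE.
  - by rewrite linearB /= sym sym0.
  - by move=> i; rewrite !mxE diag diag0 subrr.
have sup_le := labelled_supremum prob0 r_gt0 p_le k_gt0 (theta := hatQ).
have {}sup_le : network_expectation Theta0
    (fun a => penalized_gain Theta0 2^-1 a (hatQ a)) <=
    64 * r * (n%:R * ln k%:R + k%:R ^+ 2 * ln (block_const R)).
  apply: sup_le => a; have [Q [z [[[_ Q_le _] _] _ _ off]]] := hat a.
  exists z, (fun b => Q b.1 b.2); split=> [b|e].
    by rewrite -ler_norml; apply: le_trans Q_le; exact: entry_le_mx_norm.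
  by rewrite /hatQ /edge_entry off // (valP e).
(* The competitor does not depend on the data, so its correlation with the
   noise vanishes on average. *)
pose cross a := \sum_e
  (block_edge Qc zs e - p e) * noise Theta0 a e.
have cross0 : network_expectation Theta0 cross = 0.
  rewrite /cross expectation_sum big1 // => e _.
  by rewrite expectationZ expectation_noise // mulr0.
have err_le a : (n%:R ^+ 2)^-1 * frobenius (Thetahat a - Theta0) ^+ 2 <=
    (4 * bias / n%:R ^+ 2 + 4 / n%:R ^+ 2 *
       penalized_gain Theta0 2^-1 a (hatQ a))
    + (- 8 / n%:R ^+ 2) * cross a.
  have [Q [z [min_Q _ _ off]]] := hat a.
  have := basic_inequality Theta0 min_Q Qc_feasible.
  have hat_e : hatQ a = block_edge Q z.
    by apply/funext => e; rewrite /hatQ /edge_entry off // (valP e).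
  rewrite /= -hat_e -/bias -/(cross a) hat_norm => le_err.
  rewrite mulrC ler_pdivrMr ?exprn_gt0 //.
  set g := penalized_gain _ _ _ _ in le_err *.
  have -> : (4 * bias / n%:R ^+ 2 + 4 / n%:R ^+ 2 * g
     + - 8 / n%:R ^+ 2 * cross a) * n%:R ^+ 2 =
      2 * (2 * (bias + g - 2 * cross a)).
    by field; rewrite gt_eqF.
  by rewrite ler_wpM2l.
apply: le_trans (le_expectation prob0 err_le) _.
rewrite expectationD expectationD expectation_cst !expectationZ cross0.
rewrite mulr0 addr0.
apply: lerD.
  rewrite [leRHS]mulrAC ler_wpM2r ?invr_ge0 ?exprn_ge0 //.
  have -> : 4 * bias = 2 * (2 * bias) by ring.
  by rewrite ler_wpM2l.
have lnk_ge0 : 0 <= ln k%:R :> R by rewrite ln_ge0 // ler1n.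
move: (ln (block_const R)) (ln k%:R) lnK_gt0 lnk_ge0 sup_le
  => lK lk lK_gt0 lk_ge0 sup_le.
have -> : 256 * (1 + lK) * r * (lk / n%:R + k%:R ^+ 2 / n%:R ^+ 2) =
    4 / n%:R ^+ 2 * (64 * r * ((1 + lK) * (n%:R * lk + k%:R ^+ 2))).
  by field; rewrite gt_eqF.
rewrite ler_wpM2l ?divr_ge0 ?exprn_ge0 //.
apply: le_trans sup_le _; rewrite ler_wpM2l ?mulr_ge0 //.
have : 0 <= n%:R * lk + lK * (n%:R * lk).
  by rewrite addr_ge0 ?mulr_ge0 // ltW.
have : 0 <= lK * (n%:R * lk) by rewrite !mulr_ge0 // ltW.
have : 0 <= k%:R ^+ 2 :> R by rewrite exprn_ge0.
lra.
Qed.
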